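(* Let $\mathcal T\in(0,\infty)$. Let $A$ and $B$ be two nonnegative measurable functions defined on $(0,\mathcal T)$, with $A$ absolutely continuous on $(0,\mathcal T)$ and continuous on $[0,\mathcal T)$, satisfying $$\frac{d}{dt}A+B\leq[\ell(t)+m(t)\log(A+e)+n(t)\log(A+B+e)](A+e)+f(t),$$ where $\ell,m,n$ and $f$ are all nonnegative functions on $(0,\mathcal T)$ belonging to $L^1((0,\mathcal T))$. Assume further that there are two positive constants $K$ and $\alpha$ such that $$n(t)\leq K(A(t)+e)^\alpha\quad\text{for all }t\in(0,\mathcal T).$$ Then $$A(t)+\int_0^tB(s)\,ds\leq(2Q(t)+1)e^{Q(t)}\quad\text{for all }t\in(0,\mathcal T),$$ where $$Q(t)=e^{(\alpha+1)\int_0^t(m(s)+n(s))ds}\left(\log(A(0)+e)+\int_0^t\big(\ell(s)+f(s)+\log(2K)\,n(s)\big)ds+t\right).$$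
   Context: $\log$ is the natural logarithm and $e$ is Euler's number.
   Formalization: The constant K is additionally assumed to satisfy 2K ≥ 1; for smaller K the claim is false as stated, since log(2K) is negative and Q can be negative (e.g. A=B=ℓ=m=f=0, n=1, α=10, K=e^{-10}, t=1). *)

(* Defs.v *)
From HB Require Import structures.
From mathcomp Require Import all_boot all_order all_algebra.
From mathcomp Require Import all_classical all_reals all_analysis.

Set Implicit Arguments.
Unset Strict Implicit.
Unset Printing Implicit Defensive.

Import Order.TTheory GRing.Theory Num.Theory.
Import numFieldNormedType.Exports.

Local Open Scope classical_set_scope.
Local Open Scope ring_scope.

(* The intervals in the test family are required to lie in D, and D is meant to
   be an interval; F is not constrained outside D. *)
Definition abs_continuous_on (R : realType) (D : set R) (F : R -> R) : Prop :=
  forall eps : R, 0 < eps -> exists2 delta : R, 0 < delta &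
    forall (k : nat) (a b : 'I_k -> R),
      (forall i, a i <= b i) ->
      (forall i, `[a i, b i] `<=` D) ->
      trivIset [set: 'I_k] (fun i => `]a i, b i[%classic) ->
      \sum_(i < k) (b i - a i) < delta ->
      \sum_(i < k) `|F (b i) - F (a i)| < eps.

(* When 2 * K < 1 the coefficient ln (2 * K) is negative, so gronwallQ can be
   negative and need not be nondecreasing in t. *)
Definition gronwallQ (R : realType) (alpha K : R) (A l m n f : R -> R)
    (t : R) : R :=
  let mu := @lebesgue_measure R in
  expR ((alpha + 1) * \int[mu]_(s in `]0, t[) (m s + n s)) *
  (ln (A 0 + expR 1) +
   \int[mu]_(s in `]0, t[) (l s + f s + ln (2 * K) * n s) + t).

(* Main.v *)
(* Dividing the differential inequality by [A + e] and bounding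
   [n ln (1 + z)] by [(1 + z) / 2 + n ln (2 n)], where [z = B / (A + e)] and
   [ln (2 n) <= ln (2 K) + alpha ln (A + e)], gives for [u = ln (A + e)]
     [u' + z / 2 <= l + f + ln (2 K) n + 1 + (alpha + 1) (m + n) u],
   to which the linear Gronwall inequality applies: [u + \int z / 2 <= Q].
   Hence [A + e <= exp Q] and [\int B = \int z (A + e) <= 2 Q exp Q].

   Integrating the differential inequality requires that an absolutely
   continuous function be differentiable almost everywhere and be the integral
   of its derivative. Such a function is the difference of two nondecreasing
   absolutely continuous functions; the Lebesgue-Stieltjes measure of each of
   them is dominated by the Lebesgue measure, and Lebesgue's differentiation
   theorem applies to its Radon-Nikodym density. *)
Require Import Defs.
From HB Require Import structures.
From mathcomp Require Import all_boot all_order all_algebra.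
From mathcomp Require Import all_classical all_reals all_analysis.
From mathcomp Require Import measurable_realfun ring lra.

Set Implicit Arguments.
Unset Strict Implicit.
Unset Printing Implicit Defensive.

Import Order.TTheory GRing.Theory Num.Theory.
Import numFieldNormedType.Exports.

Local Open Scope classical_set_scope.
Local Open Scope ring_scope.

(** * Absolutely continuous functions *)

Section absolute_continuity.
Context {R : realType}.
Implicit Types (F G H : R -> R) (p q : R * R) (s : seq (R * R)).

(* A pair [p] stands for the interval [p.2, p.1]: this is the orientation of
   the pairs in [variation_zip]. *)
Definition nonoverlapping p q := (p.1 <= q.2) || (q.1 <= p.2).

Definition interval_family s :=
  all (fun p => p.2 <= p.1) s && pairwise nonoverlapping s.

Definition total_length s := \sum_(p <- s) (p.1 - p.2).

Definition total_increment F s := \sum_(p <- s) `|F p.1 - F p.2|.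

(** The final inequality is large so that it survives suprema and limits. The condition is on the
    whole line; functions known on an interval are first composed with [clamp]. *)
Definition abs_continuous F := forall e : R, 0 < e ->
  exists2 d : R, 0 < d & forall s, interval_family s -> total_length s < d ->
    total_increment F s <= e.

(** This one estimate serves for differences, for products of bounded functions and, with [G] equal
    to [F], for Lipschitz images. *)
Lemma abs_continuous_dominated (C : R) F G H :
  (forall x y, `|H x - H y| <= C * (`|F x - F y| + `|G x - G y|)) ->
  abs_continuous F -> abs_continuous G -> abs_continuous H.
Proof.
(* The maximum with 1 allows division by the constant whatever the sign of [C]. *)
move=> HFG acF acG e e0; pose C' := Num.max C 1.
have C'0 : 0 < C' by rewrite lt_max ltr01 orbT.
have e'0 : 0 < e / (C' + C') by rewrite divr_gt0// addr_gt0.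
have [d d0 dF] := acF _ e'0; have [d' d'0 dG] := acG _ e'0.
exists (Num.min d d'); first by rewrite lt_min d0.
move=> s fs; rewrite lt_min => /andP[sd sd'].
apply: (@le_trans _ _ (C' * (total_increment F s + total_increment G s))).
  rewrite /total_increment -big_split mulr_sumr; apply: ler_sum => p _.
  by rewrite (le_trans (HFG _ _))// ler_wpM2r ?addr_ge0// le_max lexx.
have -> : e = C' * (e / (C' + C') + e / (C' + C')).
  by field; rewrite -mulr2n mulrn_eq0/= gt_eqF.
by rewrite ler_pM2l// lerD// ?dF ?dG.
Qed.

Lemma abs_continuous_comp F (phi : R -> R) :
  {homo phi : x y / x <= y} -> (forall x y, x <= y -> phi y - phi x <= y - x) ->
  abs_continuous F -> abs_continuous (F \o phi).
Proof.
move=> ndphi lphi acF e e0; have [d d0 dF] := acF _ e0.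
exists d => // s /andP[sle sno] sd.
have := dF [seq (phi p.1, phi p.2) | p <- s].
rewrite /total_increment /total_length !big_map => /=; apply.
  apply/andP; split.
    by rewrite all_map; apply: sub_all sle => p /= /ndphi.
  rewrite pairwise_map; apply: sub_pairwise sno => p q /= /orP[] pq; apply/orP.
    by left; exact: ndphi.
  by right; exact: ndphi.
apply: le_lt_trans sd; rewrite /total_length big_seq [leRHS]big_seq.
by apply: ler_sum => p ps; apply: lphi; exact: (allP sle).
Qed.

(** For [a <= b] this is the projection onto [[a, b]]. Composition with it extends a function from
    [[a, b]] to the line by its endpoint values. *)
Definition clamp (a b x : R) := Num.max a (Num.min b x).

Lemma clamp_homo a b : {homo clamp a b : x y / x <= y}.
Proof.
move=> x y xy; rewrite /clamp ge_max le_max lexx/= le_max.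
by rewrite le_min !ge_min lexx/= xy !orbT.
Qed.

Lemma clamp_id a b x : a <= x <= b -> clamp a b x = x.
Proof.
by move=> /andP[ax xb]; rewrite /clamp (min_idPr xb) (max_idPr ax).
Qed.

Lemma clamp_itv a b x : a <= b -> a <= clamp a b x <= b.
Proof.
by move=> ab; rewrite /clamp le_max lexx/= ge_max ab ge_min lexx.
Qed.

Lemma clamp_lipschitz a b x y : x <= y -> clamp a b y - clamp a b x <= y - x.
Proof.
move=> xy; rewrite /clamp.
have [?|?] := leP b y; have [?|?] := leP b x;
  have [?|?] := leP a b; have [?|?] := leP a x; have [?|?] := leP a y; lra.
Qed.

Lemma abs_continuous_clamp F a b :
  abs_continuous F -> abs_continuous (F \o clamp a b).
Proof.
apply: abs_continuous_comp; [exact: clamp_homo|exact: clamp_lipschitz].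
Qed.

Lemma itv_partition_family a b (l : seq R) : itv_partition a b l ->
  [/\ interval_family (zip l (a :: l)),
      all (fun p => (a <= p.2) && (p.1 <= b)) (zip l (a :: l)) &
      total_length (zip l (a :: l)) = b - a].
Proof.
elim: l a => [a|c l ih a abl].
  by move=> [_ /eqP/= <-]; rewrite /total_length big_nil subrr.
have cbl := itv_partition_cons abl.
have ac : a < c by case: abl => /= /andP[].
have [/andP[f1 f2] inl sl] := ih _ cbl.
have cb : c <= b := itv_partition_le cbl.
split.
- apply/andP; split => /=; first by rewrite (ltW ac).
  rewrite f2 andbT; apply: sub_all inl => p /andP[cp _].
  by rewrite /nonoverlapping /= cp.
- rewrite /= lexx cb/=; apply: sub_all inl => p /andP[cp ->].
  by rewrite (le_trans (ltW ac) cp).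
- by rewrite /total_length/= big_cons -/(total_length _) sl /=; lra.
Qed.

(** Every piece lies inside [q], so an interval that does not overlap [q] overlaps none of the
    pieces. *)
Lemma interval_family_subdivide s t q l : itv_partition q.2 q.1 l ->
  interval_family (s ++ q :: t) ->
  interval_family ((s ++ zip l (q.2 :: l)) ++ t).
Proof.
move=> ql; have [/andP[f1 f2] inl _] := itv_partition_family ql.
move: (zip _ _) f1 f2 inl => z f1 f2 inl.
rewrite /interval_family !all_cat !pairwise_cat/= f1 f2/=.
move=> /andP[/andP[-> /andP[_ ->]] /andP[]].
rewrite allrel_consr => /andP[sq st] /and3P[-> qt ->].
rewrite allrel_catl st !andbT/=.
apply/andP; split; last first.
  apply/allrelP => p r ps /(allP inl) /= /andP[qr2 qr1].
  case/orP: (allP sq _ ps) => h; apply/orP; [left|right].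
    exact: (le_trans h).
  exact: (le_trans qr1).
apply/allrelP => r p /(allP inl) /= /andP[qr2 qr1] pt.
case/orP: (allP qt _ pt) => h; apply/orP; [left|right].
  exact: (le_trans qr1).
exact: (le_trans h).
Qed.

(* The induction on [t] subdivides its intervals one at a time and moves the
   pieces to [s]. *)
Lemma total_variation_family_le F (d e : R) :
  (forall s, interval_family s -> total_length s < d ->
    total_increment F s <= e) ->
  forall t s, interval_family (s ++ t) -> total_length (s ++ t) < d ->
  ((total_increment F s)%:E +
   \sum_(p <- t) total_variation p.2 p.1 F <= e%:E)%E.
Proof.
move=> acF; elim=> [s|q t ih s fam len].
  by rewrite cats0 big_nil adde0 lee_fin => ? ?; exact: acF.
have sub l : itv_partition q.2 q.1 l ->
    ((total_increment F s + variation q.2 q.1 F l)%:E +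
     \sum_(p <- t) total_variation p.2 p.1 F <= e%:E)%E.
  move=> ql; have [_ _ lenl] := itv_partition_family ql.
  rewrite variation_zip//.
  have := ih (s ++ zip l (q.2 :: l)).
  rewrite /total_increment big_cat; apply.
    exact: interval_family_subdivide.
  apply: le_lt_trans len; rewrite /total_length !big_cat big_cons/=.
  by rewrite -!/(total_length _) lenl addrA.
have t0 : (0 <= \sum_(p <- t) total_variation p.2 p.1 F)%E.
  rewrite big_seq; apply: sume_ge0 => p pt; apply: total_variation_ge0.
  move: fam => /andP[+ _]; rewrite all_cat /= => /andP[_ /andP[_]].
  by move=> /allP; exact.
have q21 : q.2 <= q.1.
  by move: fam => /andP[+ _]; rewrite all_cat /= => /andP[_ /andP[]].
(* Finiteness allows this sum to be moved to the right-hand side before the supremum over the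
   partitions of [q] is taken. An infinite sum would contradict [sub] for any one partition. *)
have tfin : (\sum_(p <- t) total_variation p.2 p.1 F \is a fin_num)%E.
  have [l ql] : exists l, itv_partition q.2 q.1 l.
    move: q21; rewrite le_eqVlt => /predU1P[<-|q21].
      by exists [::]; split.
    by exists [:: q.1]; exact: itv_partition1.
  rewrite ge0_fin_numE//.
  rewrite ltNge leye_eq; apply/negP => /eqP tpoo.
  by have := sub _ ql; rewrite tpoo addey// leye_eq.
rewrite big_cons addeCA -leeBrDr; last by rewrite fin_numD tfin.
apply: ge_ereal_sup => _ /= [_ [l ql <-] <-].
rewrite leeBrDr ?fin_numD ?tfin//.
by rewrite addeA -EFinD [(_ + total_increment _ _)%R]addrC; exact: sub.
Qed.

(** * Finite variation and the variation function *)

Lemma interval_family1 p : p.2 <= p.1 -> interval_family [:: p].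
Proof. by move=> p21; rewrite /interval_family /= p21. Qed.

(** With [d] the modulus for 1, an interval shorter than [d] carries variation at most 1, and
    finitely many steps of length [d / 2] cover [[a, b]]. *)
Lemma abs_continuous_total_variation_lty F a b : a <= b ->
  abs_continuous F -> (total_variation a b F < +oo)%E.
Proof.
move=> ab /(_ 1 ltr01)[d d0 acF].
have TV1 x y : x <= y -> y - x < d -> (total_variation x y F <= 1)%E.
  move=> xy yxd.
  have := @total_variation_family_le _ _ _ acF [:: (y, x)] [::].
  rewrite /total_length /total_increment !big_seq1 big_nil add0e; apply => //.
  exact: interval_family1.
have step n : (total_variation a (a + n%:R * (d / 2)) F <= n%:R%:E)%E.
  elim: n => [|n ih]; first by rewrite mul0r addr0 total_variationxx.
  have d20 : 0 <= d / 2 by rewrite divr_ge0// ltW.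
  rewrite (@total_variationD _ _ _ (a + n%:R * (d / 2))); last 2 first.
  - by rewrite lerDl mulr_ge0.
  - by rewrite lerD2l ler_wpM2r// ler_nat.
  rewrite -[in leRHS]natr1 EFinD leeD// TV1//; last by rewrite -natr1; lra.
  by rewrite lerD2l ler_wpM2r// ler_nat.
pose n := (Num.truncn ((b - a) / (d / 2))).+1.
have bn : b <= a + n%:R * (d / 2).
  rewrite -lerBlDl -ler_pdivrMr ?divr_gt0//.
  by apply/ltW/truncnS_gt.
apply: le_lt_trans (ltry n%:R); apply: le_trans (step n).
by rewrite (total_variationD F ab bn) leeDl// total_variation_ge0.
Qed.

Lemma abs_continuous_total_variation_fin_num F a b : a <= b ->
  abs_continuous F -> total_variation a b F \is a fin_num.
Proof.
move=> ab acF; rewrite ge0_fin_numE ?total_variation_ge0//.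
exact: abs_continuous_total_variation_lty.
Qed.

Definition variation_function F a x := fine (total_variation a x F).

Lemma variation_functionB F a x y : a <= x -> x <= y -> abs_continuous F ->
  variation_function F a y - variation_function F a x =
  fine (total_variation x y F).
Proof.
move=> ax xy acF; rewrite /variation_function (total_variationD F ax xy).
by rewrite fineD ?abs_continuous_total_variation_fin_num// addrAC subrr add0r.
Qed.

Lemma variation_function_ge F a x y : a <= x -> x <= y -> abs_continuous F ->
  `|F y - F x| <= variation_function F a y - variation_function F a x.
Proof.
move=> ax xy acF; rewrite variation_functionB// -lee_fin fineK.
  exact: total_variation_ge.
exact: abs_continuous_total_variation_fin_num.
Qed.

(** The increments of the variation function are total variations, so [total_variation_family_le],
    applied to the clamped family, gives the same modulus [d] as for [F]. *)
Lemma abs_continuous_variation_function F a b : a <= b -> abs_continuous F ->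
  abs_continuous (variation_function F a \o clamp a b).
Proof.
move=> ab acF e e0; have [d d0 dF] := acF e e0.
exists d => // s /andP[sle sno] sd.
pose s' := [seq (clamp a b p.1, clamp a b p.2) | p <- s].
have fs' : interval_family s'.
  apply/andP; split.
    by rewrite all_map; apply: sub_all sle => p /= /clamp_homo.
  rewrite pairwise_map; apply: sub_pairwise sno => p q /= /orP[] pq; apply/orP.
    by left; exact: clamp_homo.
  by right; exact: clamp_homo.
have := total_variation_family_le dF (t := s') (s := [::]) fs'.
rewrite /total_increment big_nil add0e => h; rewrite -lee_fin.
apply: le_trans (h _); last first.
  rewrite cat0s (le_lt_trans _ sd)// /total_length /s' big_map.
  rewrite big_seq [leRHS]big_seq; apply: ler_sum => p ps /=.
  by apply: clamp_lipschitz; exact: (allP sle).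
rewrite -sumEFin big_map big_seq [leRHS]big_seq; apply: lee_sum => p ps /=.
have p21 : clamp a b p.2 <= clamp a b p.1.
  by apply: clamp_homo; exact: (allP sle).
have /andP[ap2 _] := clamp_itv p.2 ab.
rewrite variation_functionB// ger0_norm ?fine_ge0 ?total_variation_ge0//.
by rewrite fineK// abs_continuous_total_variation_fin_num.
Qed.

Lemma abs_continuous_continuous F : abs_continuous F -> continuous F.
Proof.
move=> acF x; apply/cvgrPdist_le => e e0; have [d d0 dF] := acF e e0.
near=> y.
have yd : `|x - y| < d by near: y; exact: cvgr_dist_lt.
have [xy|yx] := leP x y.
  have := dF [:: (y, x)] (interval_family1 (p := (y, x)) xy).
  rewrite /total_length /total_increment !big_seq1 distrC; apply.
  by rewrite (le_lt_trans _ yd)// distrC ler_norm.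
have := dF [:: (x, y)] (interval_family1 (p := (x, y)) (ltW yx)).
rewrite /total_length /total_increment !big_seq1; apply.
by rewrite (le_lt_trans _ yd)// ler_norm.
Unshelve. all: by end_near. Qed.

(** * Indefinite integrals, Stieltjes measures and densities *)

Local Notation mu := (@lebesgue_measure R).

Lemma abs_continuous_Rintegral (f : R -> R) :
  mu.-integrable [set: R] (EFin \o f) ->
  abs_continuous (fun x => \int[mu]_(t in `]-oo, x]) f t).
Proof.
move=> intf e e0.
have [d [d0 dP]] := integral_normr_continuous intf e0.
exists d => // s fs sd.
(* Half-open intervals turn nonoverlapping into disjoint, so the integrals of [|f|] add up to its
   integral over a set of measure less than [d]. *)
pose U s := \big[setU/set0]_(p <- s) `]p.2, p.1]%classic.
have intS D : measurable D -> mu.-integrable D (EFin \o f).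
  by move=> mD; apply: integrableS intf.
have mU t : measurable (U t).
  by apply: bigsetU_measurable.
have Ud : (mu (U s) < d%:E)%E.
  apply: (@le_lt_trans _ _ (total_length s)%:E); last by rewrite lte_fin.
  elim: s fs {sd} => [|p s ih]; first by rewrite /U /total_length !big_nil measure0.
  rewrite /interval_family /= => /andP[/andP[p21 sle] /andP[_ sno]].
  rewrite /U /total_length !big_cons EFinD.
  apply: (le_trans (measureU2 _ _ _)) => //; first exact: mU.
  apply: leeD; last by apply: ih; rewrite /interval_family sle.
  have /= -> := lebesgue_measure_itv `]p.2, p.1].
  by rewrite lte_fin; case: ltP => // _; rewrite lee_fin subr_ge0.
apply/ltW; apply: le_lt_trans (dP _ (mU s) Ud).
elim: s fs {sd Ud} => [|p s ih].
  by rewrite /total_increment /U !big_nil Rintegral_set0.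
rewrite /interval_family /= => /andP[/andP[p21 sle] /andP[pno sno]].
rewrite /total_increment /U !big_cons Rintegral_setU//; last 3 first.
- exact: mU.
- by apply: integrable_norm; apply: intS; apply: measurableU => //; exact: mU.
- apply/disj_set2P; rewrite -subset0 => x [] /=.
  rewrite in_itv/= => /andP[px xp].
  rewrite -bigcup_seq => -[q /= qs]; rewrite in_itv/= => /andP[qx xq].
  by case/orP: (allP pno _ qs) => ?; lra.
apply: lerD; last by apply: ih; rewrite /interval_family sle.
rewrite Rintegral_itvB//; last exact: intS.
by apply: le_normr_Rintegral => //; exact: intS.
Qed.

(** [Rhull] provides the endpoints, equality with the interior makes them open, and an infinite
    endpoint contradicts finite measure. The empty set gets the degenerate pair [(0, 0)]. *)
Lemma bounded_open_interval (I : set R) : open I -> is_interval I ->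
  (mu I < +oo)%E -> exists p : R * R,
  [/\ p.2 <= p.1, I = `]p.2, p.1[%classic & mu I = (p.1 - p.2)%:E].
Proof.
move=> /interior_id oI /is_intervalP itvI; move: (Rhull I) itvI oI => i.
move=> ->; have [->|/set0P[z zi]] := eqVneq [set` i] set0.
  by exists (0, 0); rewrite measure0 subrr set_itv_ge// bnd_simp ltxx.
have itvE := lebesgue_measure_itv.
case: i zi => [[x a|[|]] [y b|[|]]] //= zi oI.
- rewrite -oI interior_itv itvE/= lte_fin.
  case: ifPn => [ab _|]; first by exists (b, a); rewrite /= -EFinB (ltW ab).
  rewrite -leNgt => ba; have : [set` Interval (BSide x a) (BSide y b)] z by [].
  by rewrite -oI interior_itv set_itv_ge// bnd_simp -leNgt.
- by move: zi; rewrite in_itv/= andbF.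
- by rewrite itvE/= ltry addye.
- by rewrite itvE/= ltNyr addey.
- by rewrite itvE/=.
Qed.

Lemma nonoverlapping_disjoint p q : p.2 < p.1 -> q.2 < q.1 ->
  `]p.2, p.1[ `&` `]q.2, q.1[ `<=` set0 -> nonoverlapping p q.
Proof.
move=> p21 q21 pq; rewrite /nonoverlapping.
case: leP => //= q2p1; case: leP => //= p2q1.
pose x := Num.max p.2 q.2; pose y := Num.min p.1 q.1.
have xy : x < y by rewrite /x /y lt_min !gt_max p21 q2p1 p2q1 q21.
have [] := pq ((x + y) / 2); split; rewrite /= in_itv/=.
  have : p.2 <= x by rewrite le_max lexx.
  have : y <= p.1 by rewrite ge_min lexx.
  lra.
have : q.2 <= x by rewrite le_max lexx orbT.
have : y <= q.1 by rewrite ge_min lexx orbT.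
lra.
Qed.

Lemma lebesgue_stieltjes_measure_itv (G : cumulative R R) (a b : R) : a <= b ->
  lebesgue_stieltjes_measure G `]a, b]%classic = (G b - G a)%:E.
Proof.
move=> ab; rewrite /lebesgue_stieltjes_measure /measure_extension/=.
rewrite measurable_mu_extE; last exact: is_ocitv.
exact: (wlength_itv_bnd _ _ _ ab).
Qed.

(** Outer regularity puts a null set in an open set of Lebesgue measure less than [d]. Any finitely
    many components of it form a family to which the modulus of [G] applies, and countable
    additivity passes to all of them. *)
Lemma abs_continuous_dominates (G : cumulative R R) : abs_continuous G ->
  lebesgue_stieltjes_measure G `<< mu.
Proof.
move=> acG; apply/null_content_dominatesP => A mA A0.
apply/eqP; rewrite eq_le measure_ge0 andbT.
apply/lee_addgt0Pr => e e0; rewrite add0e.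
have [d d0 dG] := acG _ e0.
have Aoo : (mu A < +oo)%E by rewrite A0 ltry.
have [U [oU AU UAd]] := lebesgue_regularity_outer mA Aoo d0.
have mU : measurable U by exact: open_measurable.
have Ud : (mu U < d%:E)%E.
  rewrite (_ : U = A `|` U `\` A); last by rewrite setDUK.
  rewrite (le_lt_trans _ UAd)//.
  rewrite (le_trans (measureU2 _ _ _))//; first exact: measurableD.
  by rewrite [X in (X + _)%E]A0 add0e.
pose I := open_disjoint_itv oU.
have oI k : open (I k) := @open_disjoint_itv_open _ _ oU k.
have mI k : measurable (I k) by exact: open_measurable.
have IU : U = \bigcup_k I k := @open_disjoint_itv_bigcup _ _ oU.
have tI : trivIset setT I := @open_disjoint_itv_trivIset _ _ oU.
have /choice[P /all_and3[P21 PI muP]] : forall k, exists p : R * R,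
    [/\ p.2 <= p.1, I k = `]p.2, p.1[%classic & mu (I k) = (p.1 - p.2)%:E].
  move=> k; apply: bounded_open_interval => //.
    exact: open_disjoint_itv_is_interval.
  rewrite (le_lt_trans _ (lt_trans Ud (ltry _)))// le_measure ?inE//.
    exact: mI.
  by rewrite IU; exact: bigcup_sup.
apply: (@le_trans _ _ (lebesgue_stieltjes_measure G U)).
  by apply: le_measure; rewrite ?inE.
rewrite [in leLHS]IU measure_bigcup//=; last by move=> k _; exact: mI.
apply: lime_le; first exact: is_cvg_nneseries.
apply: nearW => n.
(* Degenerate pairs are dropped: a point in the interior of another interval
   is not [nonoverlapping] with it. *)
pose s := [seq P k | k <- [seq k <- iota 0 n | (P k).2 < (P k).1]].
have sE (f : R * R -> R) : (forall p, p.1 = p.2 -> f p = 0) ->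
    \sum_(p <- s) f p = \sum_(0 <= k < n) f (P k).
  move=> f0; rewrite /s big_map big_filter /index_iota subn0 big_mkcond.
  apply: eq_bigr => k _; case: ifPn => // /negPf Pk.
  by rewrite f0//; apply/eqP; rewrite eq_le P21 andbT leNgt Pk.
have fams : interval_family s.
  apply/andP; split.
    by rewrite all_map; apply/allP => k _ /=; exact: P21.
  rewrite /s pairwise_map.
  have := iota_uniq 0 n; rewrite uniq_pairwise.
  pose pos : pred nat := fun k => (P k).2 < (P k).1.
  move=> /(pairwise_filter pos).
  apply: (@sub_in_pairwise _ pos) (filter_all _ _) => i j iP jP /= ij.
  apply: nonoverlapping_disjoint => //; rewrite -!PI.
  by rewrite ((trivIsetP.1 tI) i j).
apply: (@le_trans _ _ (total_increment G s)%:E); last first.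
  rewrite lee_fin; apply: dG => //; rewrite -lte_fin.
  apply: le_lt_trans Ud.
  rewrite /total_length sE; last by move=> p ->; rewrite subrr.
  rewrite -sumEFin IU measure_bigcup//=; last by move=> k _; exact: mI.
  under eq_bigr do rewrite -muP.
  rewrite (eq_eseriesl (Q := xpredT))//; last by move=> k; rewrite in_setT.
  exact: nneseries_lim_ge.
rewrite /total_increment sE; last by move=> p ->; rewrite subrr normr0.
rewrite -sumEFin big_mkcond; apply: lee_sum => k _; case: ifPn => // _.
(* The right endpoint is added because the measure of a half-open interval is an increment of
   [G]. *)
apply: (@le_trans _ _ (lebesgue_stieltjes_measure G `](P k).2, (P k).1]%classic)).
  apply: le_measure; rewrite ?inE//; first exact: mI.
  by rewrite PI; apply: subset_itv; rewrite bnd_simp.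
by rewrite lebesgue_stieltjes_measure_itv// lee_fin ler_norm.
Qed.

Lemma nondecreasing_abs_continuous_density G a b :
  {homo G : x y / x <= y} -> abs_continuous G ->
  exists2 g : R -> R, mu.-integrable [set: R] (EFin \o g) &
  forall x y, a <= x -> x <= y -> y <= b ->
    G y - G x = \int[mu]_(t in `]x, y]) g t.
Proof.
move=> ndG acG; have [ab|ba] := leP a b; last first.
  exists (cst 0); first exact: integrable0.
  by move=> x y ax xy yb; lra.
have rcG := right_continuousW (abs_continuous_continuous acG).
pose Gc : cumulative R R := HB.pack G (isCumulative.Build R _ R G ndG rcG).
have mab : measurable (`]a, b]%classic : set (measurableTypeR R)).
  exact: measurable_itv.
(* The measure is restricted to []a, b]] to make it finite, so that its Radon-Nikodym density is
   integrable on the whole line. *)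
have fin_ab : (lebesgue_stieltjes_measure Gc `]a, b]%classic < +oo)%E.
  by rewrite lebesgue_stieltjes_measure_itv// ltry.
pose nu : {finite_measure set (measurableTypeR R) -> \bar R} :=
  mfrestr mab fin_ab.
have dom : nu `<< mu.
  apply/null_content_dominatesP => A mA A0.
  have /null_content_dominatesP := @abs_continuous_dominates Gc acG.
  apply; first exact: measurableI.
  apply/eqP; rewrite eq_le measure_ge0 andbT -A0.
  by apply: le_measure; rewrite ?inE//; exact: measurableI.
have [g [g0 gfin ig nuE]] := radon_nikodym_sigma_finite dom.
have gE : EFin \o (fine \o g) = g by apply/funext => x /=; rewrite fineK.
exists (fine \o g); first by rewrite gE.
move=> x y ax xy yb.
rewrite /Rintegral [X in fine X](_ : _ = (\int[mu]_(t in `]x, y]) g t)%E); last first.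
  by apply: eq_integral => t _; rewrite -gE.
rewrite -nuE//= /mfrestr /mrestr setIidl; last first.
  by apply: subset_itv; rewrite bnd_simp.
by rewrite lebesgue_stieltjes_measure_itv.
Qed.

(** * Differentiation almost everywhere *)

Lemma is_derive_Rintegral (f : R -> R) :
  mu.-integrable [set: R] (EFin \o f) ->
  {ae mu, forall x : R,
    is_derive x 1 (fun y : R => \int[mu]_(t in `]-oo, y]) f t) (f x)}.
Proof.
move=> intf.
have locf : locally_integrable [set: R] f.
  by apply: open_integrable_locally => //; exact: openT.
have intfy y : mu.-integrable `]-oo, y] (EFin \o f).
  by apply: integrableS intf.
apply: filterS (FTC1Ny intfy locf); first exact: (ae_filter_ringOfSetsType mu).
move=> x [dI dIE]; apply: DeriveDef; first exact: dI.
by rewrite -derive1E; exact: dIE.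
Qed.

(** Jordan decomposition: [V] and [V - F], clamped to [[a, b]], are nondecreasing and absolutely
    continuous. Their densities are [g] and [k], and [h] is [g - k]. *)
Theorem abs_continuous_FTC F a b : a < b -> abs_continuous F ->
  exists h : R -> R, [/\ mu.-integrable [set: R] (EFin \o h),
    forall x y, a <= x -> x <= y -> y <= b ->
      F y - F x = \int[mu]_(t in `]x, y]) h t &
    {ae mu, forall x, x \in `]a, b[ -> is_derive x 1 F (h x)}].
Proof.
move=> ab acF; have leab := ltW ab.
pose V := variation_function F a \o clamp a b.
have acV : abs_continuous V by exact: abs_continuous_variation_function.
have acFc := abs_continuous_clamp a b acF.
have [g ig gV] : exists2 g : R -> R, mu.-integrable [set: R] (EFin \o g) &
    forall x y, a <= x -> x <= y -> y <= b ->
      V y - V x = \int[mu]_(t in `]x, y]) g t.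
  apply: nondecreasing_abs_continuous_density => // x y xy.
  rewrite -subr_ge0 variation_functionB ?fine_ge0//.
  - exact/total_variation_ge0/clamp_homo.
  - by have /andP[] := clamp_itv x leab.
  - exact: clamp_homo.
have [k ik kV] : exists2 k : R -> R, mu.-integrable [set: R] (EFin \o k) &
    forall x y, a <= x -> x <= y -> y <= b ->
      (V y - F (clamp a b y)) - (V x - F (clamp a b x)) =
      \int[mu]_(t in `]x, y]) k t.
  apply: (@nondecreasing_abs_continuous_density
    (fun x => V x - F (clamp a b x))) => [x y xy|].
    rewrite -subr_ge0 (_ : _ - _ = V y - V x - (F (clamp a b y) - F (clamp a b x))).
      rewrite subr_ge0 (le_trans (ler_norm _))// variation_function_ge//.
      - by have /andP[] := clamp_itv x leab.
      - exact: clamp_homo.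
    lra.
  apply: (abs_continuous_dominated (C := 1)) acV acFc => x y.
  rewrite mul1r (_ : _ - _ = V x - V y - (F (clamp a b x) - F (clamp a b y))).
    exact: ler_normB.
  lra.
have igk : mu.-integrable [set: R] (EFin \o (g \- k)).
  by rewrite (_ : _ \o _ = (EFin \o g) \- (EFin \o k))%E//; exact: integrableB.
have intS D f : measurable D -> mu.-integrable [set: R] (EFin \o f) ->
    mu.-integrable D (EFin \o f).
  by move=> mD; exact: integrableS.
have FE x y : a <= x -> x <= y -> y <= b ->
    F y - F x = \int[mu]_(t in `]x, y]) (g \- k) t.
  move=> ax xy yb; rewrite RintegralB//; [|exact: intS..].
  rewrite -gV// -kV// !clamp_id ?ax ?yb ?(le_trans ax) ?(le_trans xy)//.
  lra.
exists (g \- k); split => //.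
apply: filterS (is_derive_Rintegral igk);
  first exact: (ae_filter_ringOfSetsType mu).
move=> x dI xab.
have [ax xb] : a < x /\ x < b by move: xab; rewrite in_itv => /andP.
pose I y := \int[mu]_(t in `]-oo, y]) (g \- k) t.
(* On [[a, b]] the function [F] is the indefinite integral [I] up to this constant, hence inherits
   its derivative at interior points. *)
have {}dI : is_derive x 1 (cst (F a - I a) + I) (g x - k x).
  by rewrite -[g x - k x]add0r; apply: is_deriveD; exact: dI.
apply: near_eq_is_derive dI.
near=> y; have ay : a <= y by near: y; exact: lt_le_nbhsr.
have yb : y <= b by apply/ltW; near: y; exact: lt_nbhsl.
have := FE a y (lexx _) ay yb.
rewrite -(@Rintegral_itvB _ _ -oo%O (BRight y))//; last exact: intS.
rewrite -/(I _) -/(I _) => FI.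
by rewrite /= fctE /cst; lra.
Unshelve. all: by end_near. Qed.


(* The left endpoint 0 is reached by letting [h] tend to 0 in [clamp h t]. *)
Lemma abs_continuous_on_clamp F (T t : R) : 0 < t -> t < T ->
  abs_continuous_on `]0, T[ F -> {within `[0, T[, continuous F} ->
  abs_continuous (F \o clamp 0 t).
Proof.
move=> t0 tT acF cF e e0; have [d d0 dF] := acF e e0.
exists d => // s /andP[sle sno] sd.
have F0 : F x @[x --> 0^'+] --> F 0.
  have : {within `[0, t], continuous F}.
    by apply: continuous_subspaceW cF; apply: subset_itvl; rewrite bnd_simp.
  by move=> /(continuous_within_itvP _ t0)[].
have cvgF x : F (clamp h t x) @[h --> 0^'+] --> F (clamp 0 t x).
  (* Either [clamp h t x] is [h] itself, and continuity at 0 applies, or it does not depend on [h]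
     once [h] is small. *)
  have [m0|m0] := leP (Num.min t x) 0.
    rewrite /clamp (max_idPl m0); apply: cvg_trans F0.
    apply: near_eq_cvg; near=> h; rewrite (max_idPl _)// (le_trans m0)//.
  apply: cvg_near_cst; near=> h; rewrite /clamp (max_idPr (ltW m0)).
  by rewrite (max_idPr _)//; near: h; exact: nbhs_right_le.
have : total_increment (F \o clamp h t) s @[h --> 0^'+] -->
    total_increment (F \o clamp 0 t) s.
  rewrite /total_increment; elim: s {sle sno sd} => [|p s ih].
    by rewrite big_nil; under eq_fun do rewrite big_nil; exact: cvg_cst.
  rewrite big_cons; under eq_fun do rewrite big_cons.
  by apply: cvgD ih; apply: cvg_norm; apply: cvgB; exact: cvgF.
(* The bound is closed under limits, so it suffices to prove it for small positive [h], where the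
   clamped intervals lie in []0, T[]. *)
move=> /cvgr_to_le; apply; near=> h.
have h0 : 0 < h by near: h; exact: nbhs_right_gt.
have ht : h <= t by near: h; exact: nbhs_right_le.
pose p0 : R * R := (0, 0).
have nth21 (i : 'I_(size s)) : (nth p0 s i).2 <= (nth p0 s i).1.
  by apply: (allP sle); exact: mem_nth.
rewrite /total_increment (big_nth p0) big_mkord.
apply/ltW/(dF (size s) (fun i => clamp h t (nth p0 s i).2)
                       (fun i => clamp h t (nth p0 s i).1)).
- by move=> i; exact: clamp_homo.
- move=> i x /=; rewrite !in_itv/= => /andP[hx xt].
  have /andP[h2 _] := clamp_itv (nth p0 s i).2 ht.
  have /andP[_ h1] := clamp_itv (nth p0 s i).1 ht.
  by rewrite (lt_le_trans h0 (le_trans h2 hx))/= (le_lt_trans (le_trans xt h1)).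
- apply/trivIsetP => i j _ _ ij; rewrite -subset0 => x [] /=.
  rewrite !in_itv/= => /andP[ix xi] /andP[jx xj].
  have : nonoverlapping (nth p0 s i) (nth p0 s j) ||
         nonoverlapping (nth p0 s j) (nth p0 s i).
    move: ij; rewrite neq_lt => /orP[] ij; apply/orP; [left|right];
      by apply: (pairwiseP p0 sno); rewrite ?inE ?ltn_ord.
  by rewrite /nonoverlapping => /orP[|] /orP[] /(clamp_homo h t) ?; lra.
- apply: le_lt_trans sd; rewrite /total_length (big_nth p0) big_mkord.
  by apply: ler_sum => i _; exact: clamp_lipschitz.
Unshelve. all: by end_near. Qed.

Lemma abs_continuousM_bounded (F G : R -> R) (M : R) :
  (forall x, `|F x| <= M) -> (forall x, `|G x| <= M) ->
  abs_continuous F -> abs_continuous G -> abs_continuous (F \* G).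
Proof.
move=> FM GM; apply: (abs_continuous_dominated (C := M)) => x y.
rewrite (_ : _ - _ = G x * (F x - F y) + F y * (G x - G y)); last first.
  by rewrite /=; ring.
by rewrite (le_trans (ler_normD _ _))// [leRHS]mulrDr !normrM lerD// ler_wpM2r.
Qed.

Lemma abs_continuous_bounded (F : R -> R) a b : a <= b -> abs_continuous F ->
  exists M, forall x, `|F (clamp a b x)| <= M.
Proof.
move=> ab acF; exists (`|F a| + variation_function F a b) => x.
have /andP[ax xb] := clamp_itv x ab.
move: (clamp a b x) ax xb => y ay yb.
have := variation_function_ge (lexx a) ay acF.
have := variation_function_ge ay yb acF.
have Va : variation_function F a a = 0.
  by rewrite /variation_function total_variationxx.
rewrite Va; have := ler_normD (F a) (F y - F a).
rewrite subrKC; have := normr_ge0 (F b - F y); lra.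
Qed.

End absolute_continuity.

(** * Gronwall inequalities *)

(** Used to pass absolute continuity from [A] to [ln (A + e)]. It comes from [ln (1 + s) <= s] at
    [s = (x - y) / y]. *)
Lemma ler_dist_ln (R : realType) (x y : R) : 1 <= x -> 1 <= y ->
  `|ln x - ln y| <= `|x - y|.
Proof.
wlog xy : x y / y <= x.
  move=> wlg x1 y1; have [|/ltW] := leP y x => xy; first exact: wlg.
  by rewrite distrC [leRHS]distrC wlg.
move=> x1 y1.
have y0 : 0 < y by rewrite (lt_le_trans _ y1).
have x0 : 0 < x by rewrite (lt_le_trans _ x1).
rewrite !ger0_norm ?subr_ge0 ?ler_ln ?posrE//.
rewrite -ln_div ?posrE// (_ : x / y = 1 + (x - y) / y); last first.
  by field; rewrite gt_eqF.
rewrite (le_trans (le_ln1Dx _))//.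
  by rewrite (lt_le_trans (ltrN10 _))// divr_ge0 ?subr_ge0// ltW.
by rewrite ler_pdivrMr// ler_peMr// subr_ge0.
Qed.

(** Used to make the integrating factor absolutely continuous. It comes from [1 + s <= exp s] at
    [s = x - y], after factoring out [exp (- x) <= 1]. *)
Lemma ler_dist_expRN (R : realType) (x y : R) : 0 <= x -> 0 <= y ->
  `|expR (- x) - expR (- y)| <= `|x - y|.
Proof.
wlog xy : x y / x <= y.
  move=> wlg x0 y0; have [|/ltW] := leP x y => xy; first exact: wlg.
  by rewrite distrC [leRHS]distrC wlg.
move=> x0 y0; rewrite distrC [leRHS]distrC [`|y - x|]ger0_norm ?subr_ge0//.
rewrite distrC ger0_norm ?subr_ge0 ?ler_expR ?lerN2//.
rewrite (_ : expR (- y) = expR (- x) * expR (- (y - x))); last first.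
  by rewrite -expRD; congr expR; lra.
have ex1 : expR (- x) <= 1 by rewrite -expR0 ler_expR oppr_le0.
have := expR_ge1Dx (- (y - x)).
have := expR_gt0 (- x).
nra.
Qed.

Section linear_gronwall.
Context {R : realType}.
Local Notation mu := (@lebesgue_measure R).

(* With the integrating factor [E = exp (- \int w)], the bound
   [E t * z <= E * z] makes [z] integrable. *)
Lemma linear_gronwall (u w g z : R -> R) (t : R) : 0 < t ->
  abs_continuous u ->
  (forall x, x \in `]0, t[ -> 0 <= w x) ->
  (forall x, x \in `]0, t[ -> 0 <= g x) ->
  (forall x, x \in `]0, t[ -> 0 <= z x) ->
  mu.-integrable `]0, t[ (EFin \o w) ->
  mu.-integrable `]0, t[ (EFin \o g) ->
  measurable_fun `]0, t[ z ->
  {ae mu, forall x, x \in `]0, t[ -> exists2 du : R, is_derive x 1 u du &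
     du + z x <= g x + w x * u x} ->
  ((u t)%:E + \int[mu]_(x in `]0%R, t[) (z x)%:E <=
   (expR (\int[mu]_(x in `]0, t[) w x) *
     (u 0 + \int[mu]_(x in `]0, t[) g x))%:E)%E.
Proof.
move=> t0 acu w0 g0 z0 iw ig mz udiff.
(* Extension by zero keeps the weight nonnegative everywhere, so [W] is nonnegative and
   nondecreasing on the whole line. *)
pose w' := w \_ `]0, t[.
have w'0 x : 0 <= w' x.
  by rewrite /w' patchE; case: ifPn => // /set_mem; exact: w0.
have iw' : mu.-integrable [set: R] (EFin \o w').
  by rewrite /w' -restrict_EFin; apply/integrable_restrict => //=; rewrite setTI.
pose W x := \int[mu]_(s in `]-oo, x]) w' s.
have iw'S D : measurable D -> mu.-integrable D (EFin \o w').
  by move=> mD; exact: integrableS iw'.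
have W_ge0 x : 0 <= W x by apply: Rintegral_ge0.
have W_le x y : x <= y -> W x <= W y.
  move=> xy; rewrite -subr_ge0 /W Rintegral_itvB//; last exact: iw'S.
  exact: Rintegral_ge0.
have W0 : W 0 = 0.
  rewrite /W /w' -Rintegral_mkcondr (_ : _ `&` _ = set0) ?Rintegral_set0//.
  by rewrite -subset0 => x [] /=; rewrite !in_itv/=; lra.
have Wt : W t = \int[mu]_(x in `]0, t[) w x.
  rewrite /W /w' -Rintegral_mkcondr; congr (Rintegral _ _ _).
  by apply/seteqP; split => x /=; rewrite !in_itv/=; lra.
have acW : abs_continuous W by exact: abs_continuous_Rintegral.
pose E x := expR (- W x).
have acE : abs_continuous E.
  apply: (abs_continuous_dominated (C := 1) _ acW acW) => x y.
  rewrite mul1r (le_trans (ler_dist_expRN _ _))//.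
  by rewrite lerDl.
have E_gt0 x : 0 < E x by exact: expR_gt0.
have E_le1 x : E x <= 1 by rewrite -expR0 ler_expR oppr_le0.
have [M uM] := abs_continuous_bounded (ltW t0) acu.
(* Clamping bounds the first factor, as the product rule for absolute continuity requires. *)
pose v x := u (clamp 0 t x) * E x.
have acv : abs_continuous v.
  apply: (@abs_continuousM_bounded _ _ _ (Num.max M 1)) => [x|x||//].
  - by rewrite le_max uM.
  - by rewrite ger0_norm ?(ltW (E_gt0 _))// le_max E_le1 orbT.
  - exact: abs_continuous_clamp.
have [h [ih hE dh]] := abs_continuous_FTC t0 acv.
have ih' : mu.-integrable `]0, t[ (EFin \o h) by exact: integrableS ih.
have hvE : \int[mu]_(x in `]0, t[) h x = u t * E t - u 0.
  rewrite Rintegral_itv_bndo_bndc// -hE ?(ltW t0)// /v !clamp_id ?lexx ?(ltW t0)//.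
  by rewrite /E W0 oppr0 expR0 mulr1.
(* Here [h = E (u' - w u)], so the hypothesis gives [E z <= E g - h]. Then [E t <= E x] with
   [z >= 0], and [E <= 1] with [g >= 0], remove the variable factor. *)
have hle : {ae mu, forall x, x \in `]0, t[ -> E t * z x <= g x - h x}.
  have := is_derive_Rintegral iw'.
  move: udiff dh; apply: filterS3; first exact: (ae_filter_ringOfSetsType mu).
  move=> x udiff dh dW x0t.
  have [du ud dule] := udiff x0t.
  have {}dh := dh x0t.
  have [x0 xt] : 0 < x /\ x < t by move: x0t; rewrite in_itv => /andP.
  have dE : is_derive x 1 E (E x * - w' x).
    by apply: is_derive1_comp; apply: is_deriveN; exact: dW.
  have dv : is_derive x 1 v (u x *: (E x * - w' x) + E x *: du).
    apply: near_eq_is_derive (is_deriveM ud dE); near=> y.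
    rewrite /v fctE clamp_id//; apply/andP; split; apply/ltW; near: y.
      exact: lt_nbhsr.
    exact: lt_nbhsl.
  have w'x : w' x = w x by rewrite /w' patchE mem_set.
  have -> : h x = u x * (E x * - w x) + E x * du.
    by rewrite -w'x -(@derive_val _ _ _ _ _ _ _ dh) (@derive_val _ _ _ _ _ _ _ dv).
  have zx := z0 _ x0t; have gx := g0 _ x0t; have Ex := E_gt0 x.
  have Etx : E t <= E x by rewrite ler_expR lerN2 W_le// ltW.
  have Ex1 := E_le1 x.
  apply: (@le_trans _ _ (E x * z x)); first by rewrite ler_wpM2r.
  have h1 : E x * (du + z x) <= E x * (g x + w x * u x) by rewrite ler_wpM2l// ltW.
  have h2 : E x * g x <= g x by rewrite ler_piMl.
  move: (E x) (u x) (w x) (g x) (z x) h1 h2 => a b c d k h1 h2.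
  clear - h1 h2; lra.
set C := \int[mu]_(x in `]0, t[) g x.
have igh : mu.-integrable `]0, t[ (EFin \o (g \- h)).
  by rewrite (_ : _ \o _ = (EFin \o g) \- (EFin \o h))%E//; exact: integrableB.
have mgh : measurable_fun `]0, t[ (g \- h).
  by case/integrableP : (igh) => /measurable_EFinP.
have zE : ((E t)%:E * \int[mu]_(x in `]0%R, t[) (z x)%:E <=
           (C - (u t * E t - u 0))%:E)%E.
  rewrite -ge0_integralZl//; last 2 first.
  - exact/measurable_EFinP.
  - by rewrite lee_fin ltW.
  rewrite -hvE /C -RintegralB// fineK; last exact: integrable_fin_num.
  have mghE : measurable_fun `]0, t[ (fun x => (g x - h x)%:E).
    exact/measurable_EFinP.
  have mghn : measurable_fun `]0, t[ (fun x => `|g x - h x|%:E).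
    by apply/measurable_EFinP; exact: measurableT_comp.
  (* The integrand [g - h] is nonnegative only almost everywhere; its absolute value provides a
     majorant nonnegative at every point. *)
  have -> : (\int[mu]_(x in `]0%R, t[) (g x - h x)%:E =
      \int[mu]_(x in `]0%R, t[) `|g x - h x|%:E)%E.
    apply: ae_eq_integral => //.
    move: hle; apply: filterS; first exact: (ae_filter_ringOfSetsType mu).
    move=> x hle x0t; rewrite ger0_norm// (le_trans _ (hle x0t))//.
    by rewrite mulr_ge0 ?z0// ltW.
  apply: ae_ge0_le_integral => //.
  - by move=> x /= /z0 zx; rewrite -EFinM lee_fin mulr_ge0// ltW.
  - by apply/measurable_EFinP; exact: measurable_funM.
  - move: hle; apply: filterS; first exact: (ae_filter_ringOfSetsType mu).
    by move=> x hle /hle {}hle; rewrite lee_fin (le_trans hle)// ler_norm.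
rewrite -Wt; have WE : expR (W t) * E t = 1 by rewrite -expRD subrr expR0.
(* Multiplying [zE] by [expR (W t)], the inverse of [E t], isolates the integral of [z]. *)
rewrite (_ : expR (W t) * _ = u t + expR (W t) * (C - (u t * E t - u 0))).
  rewrite EFinD leeD2l// -[leLHS]mul1e -WE EFinM -muleA EFinM.
  by rewrite lee_pmul2l// lte_fin expR_gt0.
have : expR (W t) * E t * u t = u t by rewrite WE mul1r.
lra.
Unshelve. all: by end_near. Qed.

End linear_gronwall.

(** * Pointwise logarithmic inequalities *)

Lemma expR1_ge1 (R : realType) : 1 <= expR 1 :> R.
Proof. by rewrite -[leLHS]expR0 ler_expR. Qed.

(** The factor 2 in [2 * n] is chosen so that only half of [z] is spent; the other half stays on the
    left of the differential inequality. The case [n = 0] is apart because [ln (2 * n)] is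
    meaningful only for positive [n]. *)
Lemma mulr_ln1D_le (R : realType) (n c z : R) : 0 <= n -> 0 <= z ->
  (0 < n -> ln (2 * n) <= c) -> n * ln (1 + z) <= (1 + z) / 2 + n * c.
Proof.
move=> n0 z0; have [->|n_neq0] := eqVneq n 0.
  by rewrite !mul0r addr0 => _; rewrite divr_ge0// addr_ge0.
have {n_neq0}n0 : 0 < n by rewrite lt_neqAle eq_sym n_neq0.
move=> /(_ n0) nc.
have z1 : 0 < 1 + z by rewrite ltr_pwDl.
have n2 : 0 < 2 * n by rewrite mulr_gt0.
have y0 : 0 < (1 + z) / (2 * n) by rewrite divr_gt0.
(* [ln y <= y] for [y = (1 + z) / (2 n)]. *)
have -> : 1 + z = (1 + z) / (2 * n) * (2 * n) by field; rewrite gt_eqF.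
rewrite lnM ?posrE// mulrDr; apply: lerD; last by rewrite ler_wpM2l// ltW.
have : ln ((1 + z) / (2 * n)) <= (1 + z) / (2 * n).
  have := @le_ln1Dx _ ((1 + z) / (2 * n) - 1).
  by rewrite subrKC ltrBrDl subrr => /(_ y0); lra.
move=> /(ler_wpM2l (ltW n0)) /le_trans; apply.
by rewrite le_eqVlt; apply/orP; left; apply/eqP; field; rewrite gt_eqF.
Qed.

(** Here [x], [b] and [dx] stand for the values of [A + e], [B] and the derivative of [A] at one
    point. *)
Lemma log_differential_inequality (R : realType) (l m n f x b dx K alpha : R) :
  1 <= x -> 0 <= b -> 0 <= l -> 0 <= m -> 0 <= n -> 0 <= f ->
  0 < K -> 0 < alpha -> n <= K * x `^ alpha ->
  dx + b <= (l + m * ln x + n * ln (x + b)) * x + f ->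
  dx / x + 2^-1 * (b / x) <=
    l + f + ln (2 * K) * n + 1 + (alpha + 1) * (m + n) * ln x.
Proof.
move=> x1 b0 l0 m0 n0 f0 K0 alpha0 nK dxb.
have x0 : 0 < x by rewrite (lt_le_trans _ x1).
pose z := b / x; have z0 : 0 <= z by rewrite divr_ge0// ltW.
have u0 : 0 <= ln x by rewrite ln_ge0.
have xb : ln (x + b) = ln x + ln (1 + z).
  rewrite -lnM ?posrE ?ltr_pwDl//; congr ln.
  by rewrite /z; field; rewrite gt_eqF.
have nle : n * ln (1 + z) <= (1 + z) / 2 + n * (ln (2 * K) + alpha * ln x).
  apply: mulr_ln1D_le => // n_gt0.
  rewrite -ln_powR -lnM ?posrE ?mulr_gt0 ?powR_gt0//.
  rewrite ler_ln ?posrE ?mulr_gt0 ?powR_gt0//.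
  by rewrite -mulrA ler_wpM2l.
have fx : f / x <= f by rewrite ler_pdivrMr// ler_peMr.
have : (dx + b) / x <= l + m * ln x + n * ln (x + b) + f / x.
  by rewrite ler_pdivrMr// mulrDl divfK ?gt_eqF.
rewrite xb mulrDl -/z => h.
(* Adding this term gives [m] and [n] the common coefficient [alpha + 1]; the constant [1 / 2] left
   by [nle] is rounded up to 1. *)
have : 0 <= alpha * m * ln x by rewrite !mulr_ge0// ltW.
rewrite -/z; nra.
Qed.

Lemma derive1_near (R : realType) (F G : R -> R) (x dG : R) :
  (\forall y \near x, G y = F y) -> is_derive x 1 G dG -> derive1 F x = dG.
Proof.
move=> GF dGx; have dFx := near_eq_is_derive GF dGx.
by rewrite derive1E (@derive_val _ _ _ _ _ _ _ dFx).
Qed.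

Section integrable_EFin.
Context d (T : measurableType d) (R : realType).
Variables (mu : {measure set T -> \bar R}) (D : set T) (mD : measurable D).
Implicit Types f g : T -> R.

Lemma integrable_EFinD f g :
  mu.-integrable D (EFin \o f) -> mu.-integrable D (EFin \o g) ->
  mu.-integrable D (EFin \o (fun x => f x + g x)).
Proof. exact: integrableD. Qed.

Lemma integrable_EFinZl (k : R) f :
  mu.-integrable D (EFin \o f) -> mu.-integrable D (EFin \o (fun x => k * f x)).
Proof. exact: integrableZl. Qed.

End integrable_EFin.

(** * The Gronwall inequality with logarithmic terms *)

Theorem lemma2p5 (R : realType) (T : R) (A B l m n f : R -> R) (K alpha : R)
  (T_gt0 : 0 < T)
  (A_ge0 : forall t : R, t \in `]0, T[ -> 0 <= A t)
  (B_ge0 : forall t : R, t \in `]0, T[ -> 0 <= B t)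
  (A_meas : measurable_fun `]0, T[ A)
  (B_meas : measurable_fun `]0, T[ B)
  (A_ac : abs_continuous_on `]0, T[ A)
  (A_cont : {within `[0, T[, continuous A})
  (l_ge0 : forall t : R, t \in `]0, T[ -> 0 <= l t)
  (m_ge0 : forall t : R, t \in `]0, T[ -> 0 <= m t)
  (n_ge0 : forall t : R, t \in `]0, T[ -> 0 <= n t)
  (f_ge0 : forall t : R, t \in `]0, T[ -> 0 <= f t)
  (l_L1 : (@lebesgue_measure R).-integrable `]0, T[ (EFin \o l))
  (m_L1 : (@lebesgue_measure R).-integrable `]0, T[ (EFin \o m))
  (n_L1 : (@lebesgue_measure R).-integrable `]0, T[ (EFin \o n))
  (f_L1 : (@lebesgue_measure R).-integrable `]0, T[ (EFin \o f))
  (A_ineq : {ae @lebesgue_measure R, forall t : R, t \in `]0, T[ ->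
     derive1 A t + B t <=
       (l t + m t * ln (A t + expR 1) + n t * ln (A t + B t + expR 1))
         * (A t + expR 1) + f t})
  (K_gt0 : 0 < K) (alpha_gt0 : 0 < alpha)
  (K_ge_half : 1 <= 2 * K)
  (n_le : forall t : R, t \in `]0, T[ -> n t <= K * (A t + expR 1) `^ alpha) :
  forall t : R, t \in `]0, T[ ->
    ((A t)%:E + \int[@lebesgue_measure R]_(s in `]0%R, t[) (B s)%:E <=
     ((2 * gronwallQ alpha K A l m n f t + 1)
        * expR (gronwallQ alpha K A l m n f t))%:E)%E.
Proof.
pose mu := @lebesgue_measure R; pose e1 : R := expR 1.
have e1_ge1 : 1 <= e1 := expR1_ge1 R.
have e1_gt0 : 0 < e1 := expR_gt0 1.
(* The sign hypothesis concerns the open interval; at 0 it follows from right continuity. *)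
have A0_ge0 : 0 <= A 0.
  have T20 : 0 < T / 2 by rewrite divr_gt0.
  have : {within `[0, T / 2], continuous A}.
    by apply: continuous_subspaceW A_cont; apply: subset_itvl; rewrite bnd_simp; lra.
  move=> /(continuous_within_itvP _ T20)[_ cA _].
  apply: (cvgr_to_ge cA); near=> h; apply: A_ge0.
  rewrite in_itv/=; apply/andP; split; near: h.
    exact: nbhs_right_gt.
  exact: nbhs_right_lt.
have sub t x : t \in `]0, T[ -> x \in `]0, t[ -> x \in `]0, T[.
  rewrite !in_itv/=; lra.
have subS t : t \in `]0, T[ -> `]0, t[ `<=` `]0, T[.
  by move=> tT x; exact: sub.
have X_ge1 t : t \in `]0, T[ -> 1 <= A t + e1.
  by move=> /A_ge0; lra.
have intS t (h : R -> R) : t \in `]0, T[ -> mu.-integrable `]0, T[ (EFin \o h) ->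
    mu.-integrable `]0, t[ (EFin \o h).
  by move=> tT; apply: integrableS => //; exact: subS.
pose z x := 2^-1 * (B x / (A x + e1)).
have z_ge0 x : x \in `]0, T[ -> 0 <= z x.
  move=> xT; rewrite mulr_ge0// divr_ge0 ?B_ge0//.
  by rewrite (le_trans _ (X_ge1 _ xT)).
have z_meas : measurable_fun `]0, T[ z.
  (* The reciprocal is written with [expR] and [ln], whose measurability composes directly. *)
  apply: (eq_measurable_fun (fun x => 2^-1 * (B x * expR (- ln (A x + e1))))).
    move=> x; rewrite inE/= => xT; rewrite expRN lnK// posrE.
    by rewrite (lt_le_trans _ (X_ge1 _ xT)).
  apply: measurable_funM => //; apply: measurable_funM => //.
  apply: measurableT_comp => //; apply: measurableT_comp => //.
  by apply: measurableT_comp => //; exact: measurable_funD.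
pose Q := gronwallQ alpha K A l m n f.
(* This is where [1 <= 2 * K] enters: it makes the source term of the linear inequality nonnegative
   and [Q] nondecreasing. *)
have lnK_ge0 : 0 <= ln (2 * K) by rewrite ln_ge0.
have log_bound t : t \in `]0, T[ ->
    ((ln (A t + e1))%:E + \int[mu]_(s in `]0%R, t[) (z s)%:E <= (Q t)%:E)%E.
  move=> tT; have /andP[t0 ltT] : 0 < t < T by move: tT; rewrite in_itv.
  have acA : abs_continuous (A \o clamp 0 t).
    exact: abs_continuous_on_clamp ltT A_ac A_cont.
  have Ac_ge0 x : 0 <= A (clamp 0 t x).
    have /andP[] := clamp_itv x (ltW t0); rewrite le_eqVlt => /predU1P[<-//|x0 xt].
    by apply: A_ge0; rewrite in_itv/= x0 (le_lt_trans xt).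
  pose u x := ln (A (clamp 0 t x) + e1).
  have acu : abs_continuous u.
    apply: (abs_continuous_dominated (C := 1) _ acA acA) => x y.
    rewrite mul1r /u; apply: (le_trans (ler_dist_ln _ _)).
    - by rewrite -[leLHS]add0r lerD.
    - by rewrite -[leLHS]add0r lerD.
    - by rewrite opprD addrACA subrr addr0 lerDl.
  have [dA [_ _ dAE]] := abs_continuous_FTC t0 acA.
  have [il im in_ jf] : [/\ mu.-integrable `]0, t[ (EFin \o l),
      mu.-integrable `]0, t[ (EFin \o m), mu.-integrable `]0, t[ (EFin \o n) &
      mu.-integrable `]0, t[ (EFin \o f)] by split; exact: intS.
  have imn : mu.-integrable `]0, t[ (EFin \o (fun x => m x + n x)).
    exact: integrable_EFinD.
  have ilf : mu.-integrable `]0, t[ (EFin \o (fun x => l x + f x)).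
    exact: integrable_EFinD.
  have iln : mu.-integrable `]0, t[ (EFin \o (fun x => ln (2 * K) * n x)).
    exact: integrable_EFinZl.
  have ilfn : mu.-integrable `]0, t[
      (EFin \o (fun x => l x + f x + ln (2 * K) * n x)).
    exact: integrable_EFinD.
  have mu0t : mu `]0, t[%classic = t%:E.
    by rewrite /mu lebesgue_measure_itv/= lte_fin t0 sube0.
  have i1 : mu.-integrable `]0, t[ (EFin \o cst (1 : R)).
    apply/integrableP; split; first exact/measurable_EFinP.
    rewrite (_ : integral _ _ _ = (1 * mu `]0%R, t[%classic)%E).
      by rewrite mu0t mul1e ltry.
    by rewrite -integral_cst//; apply: eq_integral => x _ /=; rewrite normr1.
  have ig : mu.-integrable `]0, t[
      (EFin \o (fun x => l x + f x + ln (2 * K) * n x + 1)).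
    exact: integrable_EFinD.
  have iw : mu.-integrable `]0, t[ (EFin \o (fun x => (alpha + 1) * (m x + n x))).
    exact: integrable_EFinZl.
  (* The summand [t] of [gronwallQ] is the integral of the constant 1 in the source term. *)
  have QE : Q t = expR (\int[mu]_(x in `]0, t[) ((alpha + 1) * (m x + n x))) *
      (u 0 + \int[mu]_(x in `]0, t[) (l x + f x + ln (2 * K) * n x + 1)).
    have tE : \int[mu]_(x in `]0, t[) (1 : R) = t.
      by rewrite Rintegral_cst// mul1r [X in fine X]mu0t.
    rewrite RintegralZl// [X in u 0 + X]RintegralD// tE addrA.
    by rewrite /u clamp_id ?lexx ?(ltW t0).
  have utE : ln (A t + e1) = u t by rewrite /u clamp_id// lexx (ltW t0).
  rewrite QE utE; apply: linear_gronwall => //.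
  - move=> x /(sub _ _ tT) xT.
    by rewrite mulr_ge0 ?addr_ge0 ?m_ge0 ?n_ge0// ltW.
  - move=> x /(sub _ _ tT) xT.
    by rewrite !addr_ge0 ?l_ge0 ?f_ge0// mulr_ge0 ?n_ge0.
  - by move=> x /(sub _ _ tT) /z_ge0.
  - by apply: measurable_funS z_meas => //; exact: subS.
  move: A_ineq dAE; apply: filterS2; first exact: (ae_filter_ringOfSetsType mu).
  move=> x Ax dAx x0t; have xT := sub _ _ tT x0t.
  have {}dAx := dAx x0t; have {}Ax := Ax xT.
  have [x0 xt] : 0 < x /\ x < t by move: x0t; rewrite in_itv => /andP.
  (* The hypothesis speaks of [derive1 A], the fundamental theorem of the derivative of the clamped
     function; the two functions agree near [x]. *)
  have dA1 : derive1 A x = dA x.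
    apply: derive1_near dAx; near=> y; rewrite /= clamp_id//.
    by apply/andP; split; apply/ltW; near: y; [exact: lt_nbhsr|exact: lt_nbhsl].
  have Acx : A (clamp 0 t x) = A x by rewrite clamp_id// !ltW.
  exists (dA x / (A x + e1)).
    have -> : dA x / (A x + e1) = (A (clamp 0 t x) + e1)^-1 * (dA x + 0).
      by rewrite Acx addr0 mulrC.
    apply: (is_derive1_comp (f := @ln R) (g := (A \o clamp 0 t) \+ cst e1)).
    by apply: is_derive1_ln; rewrite /= Acx; have := X_ge1 _ xT; lra.
  rewrite /u Acx /z; apply: log_differential_inequality => //.
  - exact: X_ge1.
  - exact: B_ge0.
  - exact: l_ge0.
  - exact: m_ge0.
  - exact: n_ge0.
  - exact: f_ge0.
  - exact: n_le.
  - by rewrite [A x + e1 + B x]addrAC -dA1; exact: Ax.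
have ln_ge0' t : t \in `]0, T[ -> 0 <= ln (A t + e1).
  by move=> tT; rewrite ln_ge0 ?X_ge1.
have Rint_ge0 t (h : R -> R) : t \in `]0, T[ ->
    (forall x, x \in `]0, T[ -> 0 <= h x) -> 0 <= \int[mu]_(x in `]0, t[) h x.
  by move=> tT h0; apply: Rintegral_ge0 => x /= /(sub _ _ tT); exact: h0.
have Rint_le s t (h : R -> R) : s \in `]0, T[ -> t \in `]0, T[ -> s <= t ->
    mu.-integrable `]0, T[ (EFin \o h) ->
    (forall x, x \in `]0, T[ -> 0 <= h x) ->
    \int[mu]_(x in `]0, s[) h x <= \int[mu]_(x in `]0, t[) h x.
  move=> sT tT st ih h0; rewrite /Rintegral fine_le//.
  - by apply: integrable_fin_num => //; exact: intS.
  - by apply: integrable_fin_num => //; exact: intS.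
  - apply: ge0_subset_integral => //.
    + by have := intS _ _ tT ih; exact: measurable_int.
    + by move=> x /= /(sub _ _ tT) /h0; rewrite lee_fin.
    + by apply: subset_itvl; rewrite bnd_simp.
have Q_ge0 t : t \in `]0, T[ -> 0 <= Q t.
  move=> tT; rewrite -lee_fin (le_trans _ (log_bound _ tT))// adde_ge0//.
    by rewrite lee_fin ln_ge0'.
  by apply: integral_ge0 => x /= /(sub _ _ tT) /z_ge0; rewrite lee_fin.
have imnT : mu.-integrable `]0, T[ (EFin \o (fun x => m x + n x)).
  exact: integrable_EFinD.
have ilfnT : mu.-integrable `]0, T[
    (EFin \o (fun x => l x + f x + ln (2 * K) * n x)).
  apply: integrable_EFinD => //; first exact: integrable_EFinD.
  exact: integrable_EFinZl.
have Q_le s t : s \in `]0, T[ -> t \in `]0, T[ -> s <= t -> Q s <= Q t.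
  move=> sT tT st; rewrite /Q /gronwallQ.
  have lfn_ge0 x : x \in `]0, T[ -> 0 <= l x + f x + ln (2 * K) * n x.
    by move=> xT; rewrite !addr_ge0 ?l_ge0 ?f_ge0// mulr_ge0 ?n_ge0.
  have s0 : 0 < s by move: sT; rewrite in_itv/= => /andP[].
  apply: ler_pM.
  - exact: expR_ge0.
  - rewrite !addr_ge0 ?(ltW s0)//; first by rewrite ln_ge0// ler_wpDl.
    exact: Rint_ge0.
  - rewrite ler_expR ler_wpM2l ?addr_ge0 ?(ltW alpha_gt0)//.
    by apply: Rint_le => // x xT; rewrite addr_ge0 ?m_ge0 ?n_ge0.
  - by rewrite !lerD//; exact: Rint_le.
move=> t tT; rewrite -/(Q t) -/mu.
(* Monotonicity of [Q] replaces [Q s] by [Q t], giving one constant for all of []0, t[]. *)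
have X_le s : s \in `]0, T[ -> s <= t -> A s + e1 <= expR (Q t).
  move=> sT st; have X0 : 0 < A s + e1 by have := X_ge1 _ sT; lra.
  rewrite -[leLHS]lnK ?posrE// ler_expR (le_trans _ (Q_le _ _ sT tT st))//.
  rewrite -lee_fin (le_trans _ (log_bound _ sT))// leeDl//.
  by apply: integral_ge0 => x /= /(sub _ _ sT) /z_ge0; rewrite lee_fin.
have z_int : (\int[mu]_(s in `]0%R, t[) (z s)%:E <= (Q t)%:E)%E.
  by rewrite (le_trans _ (log_bound _ tT))// leeDr// lee_fin ln_ge0'.
(* Since [B = 2 z (A + e)], the uniform bound on [A + e] comes out of the integral. *)
have B_int : (\int[mu]_(s in `]0%R, t[) (B s)%:E <=
    (2 * expR (Q t))%:E * \int[mu]_(s in `]0%R, t[) (z s)%:E)%E.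
  rewrite -ge0_integralZl//; last 2 first.
  - by apply/measurable_EFinP; apply: measurable_funS z_meas => //; exact: subS.
  - by move=> x /= /(sub _ _ tT) /z_ge0; rewrite lee_fin.
  apply: ge0_le_integral => //.
  - by move=> x /= /(sub _ _ tT) /B_ge0; rewrite lee_fin.
  - by apply/measurable_EFinP; apply: measurable_funS B_meas => //; exact: subS.
  - apply/measurable_EFinP/measurable_funM => //.
    by apply: measurable_funS z_meas => //; exact: subS.
  move=> x /= x0t; have xT := sub _ _ tT x0t; rewrite -EFinM lee_fin /z.
  have X0 : 0 < A x + e1 by have := X_ge1 _ xT; lra.
  have -> : 2 * expR (Q t) * (2^-1 * (B x / (A x + e1))) =
      expR (Q t) * (B x / (A x + e1)).
    by field; rewrite gt_eqF.
  rewrite mulrCA ler_peMr ?B_ge0// ler_pdivlMr// mul1r X_le//.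
  by move: x0t; rewrite in_itv/= => /andP[_ /ltW].
apply: (@le_trans _ _ ((expR (Q t))%:E + (2 * expR (Q t))%:E * (Q t)%:E)%E).
  apply: leeD.
    by rewrite lee_fin (le_trans _ (X_le _ tT (lexx t)))// lerDl ltW.
  by rewrite (le_trans B_int)// lee_wpmul2l// lee_fin mulr_ge0// expR_ge0.
by rewrite -EFinM -EFinD lee_fin; lra.
Unshelve. all: by end_near. Qed.
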